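(* Let $\mathcal{K}^2=(K_1\Box K_1,\ldots,K_n\Box K_n,\ldots)$ be the sequence of Cartesian squares of complete graphs, and let $N=N(n)=n^2$ denote the number of vertices of its $n$-th member $K_n\Box K_n$. Then the pebbling threshold of $\mathcal{K}^2$ is $$\tau_{\mathcal{K}^2}=\Theta(\sqrt{N}),$$ i.e., a positive function $f=f(n)$ is a pebbling threshold for $\mathcal{K}^2$ if and only if $f\in\Theta(\sqrt{N})=\Theta(n)$.
   Context: Pebbling. A configuration $C$ of $t$ pebbles on a connected graph $G$ is a placement of $t$ indistinguishable pebbles on the vertices of $G$, i.e. a function $C:V(G)\to\mathbb{Z}_{\ge 0}$ with $\sum_v C(v)=t$. A pebbling step from $u$ to an adjacent vertex $v$ removes two pebbles from $u$ and places one pebble on $v$. $C$ is $r$-solvable if, after finitely many (possibly zero) pebbling steps, the vertex $r$ has at least one pebble. $C$ is solvable if it is $r$-solvable for every vertex $r$. Cartesian product. $G_1\Box G_2$ has vertex set $V(G_1)\times V(G_2)$, with $(v_1,v_2)$ adjacent to $(w_1,w_2)$ iff either $v_1=w_1$ and $v_2w_2\in E(G_2)$, or $v_2=w_2$ and $v_1w_1\in E(G_1)$. Random configurations and threshold. For a graph sequence $\mathcal{G}=(G_1,G_2,\ldots)$, let $N_n=|V(G_n)|$. Let $P_{\mathcal{G}}(n,t)$ be the probability that a configuration of $t$ pebbles on $G_n$, chosen uniformly at random from all $\binom{N_n+t-1}{t}$ configurations of $t$ (unlabeled) pebbles on $V(G_n)$, is solvable. For functions of $n$, $f\ll g$ (equivalently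 $g\gg f$) means $\lim_{n\to\infty} f(n)/g(n)=0$; $f\in O(g)$ (equivalently $g\in\Omega(f)$) means there are positive constants $c,k$ with $f(n)/g(n)<c$ for all $n>k$; $\Theta(g)=O(g)\cap\Omega(g)$. A function $f=f(n)$ is a (pebbling) threshold for $\mathcal{G}$, written $f\in\tau_{\mathcal{G}}$, if $P_{\mathcal{G}}(n,t)\to 1$ as $n\to\infty$ for every (nonnegative-integer-valued) $t=t(n)$ with $t\gg f$, and $P_{\mathcal{G}}(n,t)\to 0$ as $n\to\infty$ for every $t=t(n)$ with $t\ll f$. *)

(* Defs.v *)
(* MathComp world, with MathComp-Analysis for the limits. *)
From HB Require Import structures.
From Stdlib Require Import Relation_Operators.
From mathcomp Require Import all_boot all_order all_algebra.
From mathcomp Require Import all_classical all_reals all_analysis.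

Set Implicit Arguments.
Unset Strict Implicit.
Unset Printing Implicit Defensive.

Import Order.TTheory GRing.Theory Num.Theory.
Import numFieldNormedType.Exports.

Local Open Scope ring_scope.
Local Open Scope classical_set_scope.

Record sgraph := SGraph {
  vertex :> finType;
  adj : rel vertex;
  adj_sym : symmetric adj;
  adj_irrefl : irreflexive adj }.

Section CompleteGraph.
Variable n : nat.

Definition complete_adj : rel 'I_n := fun i j => i != j.

Lemma complete_adj_sym : symmetric complete_adj.
Proof. by move=> i j; rewrite /complete_adj eq_sym. Qed.

Lemma complete_adj_irrefl : irreflexive complete_adj.
Proof. by move=> i; rewrite /complete_adj eqxx. Qed.

Definition complete_graph : sgraph :=
  SGraph complete_adj_sym complete_adj_irrefl.
End CompleteGraph.

Section CartesianProduct.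
Variables G H : sgraph.

Definition cartesian_adj : rel (vertex G * vertex H)%type := fun v w =>
  ((v.1 == w.1) && adj v.2 w.2) || ((v.2 == w.2) && adj v.1 w.1).

Lemma cartesian_adj_sym : symmetric cartesian_adj.
Proof.
move=> v w; rewrite /cartesian_adj ![adj v.2 _]adj_sym ![adj v.1 _]adj_sym.
by rewrite (eq_sym v.1) (eq_sym v.2).
Qed.

Lemma cartesian_adj_irrefl : irreflexive cartesian_adj.
Proof. by move=> v; rewrite /cartesian_adj !adj_irrefl !andbF. Qed.

Definition cartesian_product : sgraph :=
  SGraph cartesian_adj_sym cartesian_adj_irrefl.
End CartesianProduct.

Definition config (G : sgraph) := {ffun G -> nat}.

Definition pebbling_step (G : sgraph) (C C' : config G) : Prop :=
  exists u v : G, [/\ adj u v, (2 <= C u)%N &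
    C' = [ffun w => if w == u then (C w - 2)%N
                    else if w == v then (C w).+1 else C w]].

Definition solvable_at (G : sgraph) (r : G) (C : config G) : Prop :=
  exists C' : config G,
    clos_refl_trans (config G) (@pebbling_step G) C C' /\ (0 < C' r)%N.

Definition config_solvable (G : sgraph) (C : config G) : Prop :=
  forall r : G, solvable_at r C.

(* Each vertex of a configuration of [t] pebbles carries at most [t] pebbles;
   taking values in ['I_t.+1] makes the set of such configurations finite. *)
Definition configs (G : sgraph) (t : nat) : {set {ffun G -> 'I_t.+1}} :=
  [set D : {ffun G -> 'I_t.+1} | (\sum_(v : G) D v == t)%N].

Definition to_config (G : sgraph) (t : nat) (D : {ffun G -> 'I_t.+1}) :
  config G := [ffun v => val (D v)].

Lemma to_config_inj (G : sgraph) (t : nat) : injective (@to_config G t).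
Proof.
move=> D E /ffunP DE; apply/ffunP => v; apply: val_inj.
by have := DE v; rewrite !ffunE.
Qed.

Lemma configsP (G : sgraph) (t : nat) (C : config G) :
  (\sum_(v : G) C v = t)%N <-> exists2 D, D \in configs G t & C = to_config D.
Proof.
split=> [Ct|[D]]; last first.
  by rewrite inE => /eqP Dt ->; under eq_bigr do rewrite ffunE.
have leC v : (C v < t.+1)%N by rewrite ltnS -Ct (bigD1 v) //= leq_addr.
exists [ffun v => Ordinal (leC v)]; last by apply/ffunP => v; rewrite !ffunE.
by rewrite inE -[X in _ == X]Ct; under eq_bigr do rewrite ffunE.
Qed.

Lemma card_configs (G : sgraph) (t : nat) : (0 < #|G|)%N ->
  #|configs G t| = 'C(#|G| + t - 1, t).
Proof.
case EG: #|G| => [//|m] _.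
pose h (D : {ffun G -> 'I_t.+1}) := tcast EG (fgraph D).
have sumh D : (\sum_(x <- h D) x = \sum_(v : G) D v)%N.
  rewrite /h val_tcast big_tuple (reindex (@enum_rank G)) /=; last first.
    by exists enum_val => x _; rewrite ?enum_rankK ?enum_valK.
  by apply: eq_bigr => v _; rewrite tnth_fgraph enum_rankK.
have h_inj : injective h.
  by move=> D E /(can_inj (tcastK EG)) /(can_inj fgraphK).
have -> : 'C(m.+1 + t - 1, t) = 'C(m + t, m).
  by rewrite addSn subn1 /= -[RHS]bin_sub ?leq_addr // addKn.
rewrite -card_ord_partitions -(card_imset _ h_inj).
apply: eq_card => s; rewrite inE; apply/imsetP/idP => [[D]|].
  by rewrite inE -sumh => + ->.
pose D := Finfun (tcast (esym EG) s).
have hD : h D = s by rewrite /h FinfunK tcastKV.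
by move=> ss; exists D; rewrite ?inE -?sumh ?hD.
Qed.

Definition prob_solvable (R : realType) (G : nat -> sgraph) (n t : nat) : R :=
  #|[set D in configs (G n) t | `[< config_solvable (to_config D) >]]|%:R
  / #|configs (G n) t|%:R.

(* As [x / 0 = 0] here, that the quotients be meaningful has to be said
   explicitly: otherwise [t = 0] would satisfy [much_less f t]. *)
Definition much_less (R : realType) (f g : nat -> R) : Prop :=
  (\forall n \near \oo, g n != 0) /\
  (f n / g n @[n --> \oo] --> (0 : R)).

Definition in_bigO (R : realType) (f g : nat -> R) : Prop :=
  exists c k : R, [/\ 0 < c, 0 < k &
    forall n : nat, k < n%:R -> g n != 0 /\ f n / g n < c].

Definition in_bigOmega (R : realType) (f g : nat -> R) : Prop := in_bigO g f.

Definition in_bigTheta (R : realType) (f g : nat -> R) : Prop :=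
  in_bigO f g /\ in_bigOmega f g.

Definition pebbling_threshold (R : realType) (G : nat -> sgraph)
    (f : nat -> R) : Prop :=
  (forall t : nat -> nat, much_less f (fun n => (t n)%:R) ->
     prob_solvable R G n (t n) @[n --> \oo] --> (1 : R)) /\
  (forall t : nat -> nat, much_less (fun n => (t n)%:R) f ->
     prob_solvable R G n (t n) @[n --> \oo] --> (0 : R)).

(* The sequence starts at [n = 1]; the empty graph at index [0] is a dummy
   term, to which none of the asymptotic notions above is sensitive. *)
Definition complete_square (n : nat) : sgraph :=
  cartesian_product (complete_graph n) (complete_graph n).

Lemma card_complete_square (n : nat) : #|complete_square n| = (n ^ 2)%N.
Proof. by rewrite card_prod card_ord. Qed.

(* Main.v *)
(** A uniform configuration grows pebble by pebble as a Polya urn, so means of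
    statistics of a [t]-pebble configuration obey one-step recursions.

    Few pebbles: the mean number of pairs of pebbles sharing a vertex is
    [t (t - 1) / (N + 1)], so when [t] is small compared with [sqrt N] usually
    no move is possible at all.

    Many pebbles: read the vertices of [K_n [] K_n] as the edges of [K_{n,n}].
    After [12 n] pebbles, a union bound over the cuts of [K_{n,n}] shows that
    the occupied edges have with high probability a connected component with
    at least [n / 3] edges.  Among the next [B n] pebbles, at least [B / 3]
    on average land on that component again, and three of them suffice: a pair of
    pebbles walks along singly occupied edges of the component until it meets
    another pair on a line, and two pairs on a line reach every vertex. *)
Require Import Defs.
From Stdlib Require Import Relation_Operators.
From mathcomp Require Import all_boot all_order all_algebra.
From mathcomp Require Import all_classical all_reals all_analysis.
From mathcomp Require Import zify ring lra.

Set Implicit Arguments.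
Unset Strict Implicit.
Unset Printing Implicit Defensive.

Import Order.TTheory GRing.Theory Num.Theory.
Import numFieldNormedType.Exports.

Local Open Scope ring_scope.

(** * Uniform configurations as a Polya urn *)

Section UniformConfiguration.
Variables (R : realType) (G : sgraph).
Hypothesis G_gt0 : (0 < #|G|)%N.
Implicit Types (C : config G) (g h : config G -> R) (t k : nat) (v w : G).

Definition csize C : nat := (\sum_v C v)%N.

Definition add_pebble v C : config G := [ffun w => (C w + (w == v))%N].

Lemma csize_add_pebble v C : csize (add_pebble v C) = (csize C).+1.
Proof.
rewrite /csize; under eq_bigr do rewrite ffunE.
rewrite big_split /= -addn1; congr addn.
by rewrite -big_mkcond /= big_pred1_eq.
Qed.

Lemma csize_to_config t (D : {ffun G -> 'I_t.+1}) :
  csize (to_config D) = (\sum_v D v)%N.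
Proof. by apply: eq_bigr => v _; rewrite ffunE. Qed.

Definition mean t g : R :=
  (\sum_(D in configs G t) g (to_config D)) / #|configs G t|%:R.

Lemma card_configs_gt0 t : (0 < #|configs G t|)%N.
Proof. by rewrite card_configs // bin_gt0; lia. Qed.

(** Removing a pebble from [v] is a bijection from the [t.+1]-pebble configurations occupied at [v]
    onto the [t]-pebble ones; the factor [D v] kills the remaining terms. *)
Lemma sum_configs_at t v g :
  \sum_(D in configs G t.+1) (D v)%:R * g (to_config D) =
  \sum_(D in configs G t) (D v).+1%:R * g (add_pebble v (to_config D)).
Proof.
pose up (D : {ffun G -> 'I_t.+1}) : {ffun G -> 'I_t.+2} :=
  [ffun w => inord (D w + (w == v))].
pose dn (D : {ffun G -> 'I_t.+2}) : {ffun G -> 'I_t.+1} :=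
  [ffun w => inord (D w - (w == v))].
have upE D w : up D w = (D w + (w == v))%N :> nat.
  rewrite ffunE inordK //; have := ltn_ord (D w); case: (w == v) => /=; lia.
(* [inord] in [dn] is faithful here: [v] loses a pebble, and any other vertex holds at most [t]
   because one pebble sits on [v]. *)
have le_csize (D : {ffun G -> 'I_t.+2}) w : D \in configs G t.+1 ->
    (0 < D v)%N -> (D w - (w == v) <= t)%N.
  rewrite inE => /eqP; case: eqVneq => [-> |wv].
    by have := ltn_ord (D v); lia.
  by rewrite (bigD1 v) //= (bigD1 w) //= subn0 => Dt Dv; lia.
have dnE D w : D \in configs G t.+1 -> (0 < D v)%N ->
    dn D w = (D w - (w == v))%N :> nat.
  by move=> Dt Dv; rewrite ffunE inordK // ltnS le_csize.
have csup D : csize (to_config (up D)) = (csize (to_config D)).+1.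
  rewrite -(csize_add_pebble v); congr csize; apply/ffunP => w.
  by rewrite [LHS]ffunE /= upE !ffunE.
rewrite (bigID (fun D : {ffun G -> 'I_t.+2} => (0 < D v)%N)) /=.
rewrite [X in _ + X]big1 ?addr0; last first.
  by move=> D /andP[_]; rewrite lt0n negbK => /eqP ->; rewrite mul0r.
rewrite (reindex_onto up dn); last first.
  move=> D /andP[Dt Dv]; apply/ffunP => w; apply: val_inj => /=.
  by rewrite upE dnE //; case: eqVneq => [->|_]; rewrite ?subnK // subn0 addn0.
apply: eq_big => [D|D /andP[/andP[Dt Dv] _]].
  have upD : (up D \in configs G t.+1) = (D \in configs G t).
    by rewrite !inE -!csize_to_config csup eqSS.
  rewrite upD upE eqxx addn1 /= andbT.
  case Dt: (D \in configs G t) => //=.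
  apply/eqP/ffunP => w; apply: val_inj => /=.
  rewrite dnE ?upD ?Dt // ?upE ?eqxx ?addn1 //.
  by lia.
rewrite upE eqxx addn1; congr (_ * g _); apply/ffunP => w.
by rewrite [LHS]ffunE /= upE !ffunE.
Qed.

Lemma card_configsS t :
  (t.+1 * #|configs G t.+1| = (#|G| + t) * #|configs G t|)%N.
Proof.
rewrite !card_configs // addnS subn1 /=.
have -> : (#|G| + t - 1 = (#|G| + t).-1)%N by lia.
by rewrite mul_bin_diag.
Qed.

Definition urn_step t g C : R :=
  \sum_v (C v).+1%:R / (#|G| + t)%:R * g (add_pebble v C).

(* Sorting the pairs (configuration, pebble) by the configuration left after
   removing the pebble: uniform configurations grow like a Polya urn, the next
   pebble landing on [v] with probability proportional to [C v + 1]. *)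
Lemma meanS t g : mean t.+1 g = mean t (urn_step t g).
Proof.
have N0 : (#|G| + t)%:R != 0 :> R by rewrite pnatr_eq0; lia.
have c0 s : #|configs G s|%:R != 0 :> R.
  by rewrite pnatr_eq0 -lt0n card_configs_gt0.
have t0 : t.+1%:R != 0 :> R by rewrite pnatr_eq0.
rewrite /mean /urn_step; apply: (mulfI t0).
have -> : \sum_(D in configs G t) \sum_v ((to_config D) v).+1%:R / (#|G| + t)%:R
     * g (add_pebble v (to_config D)) =
   (#|G| + t)%:R^-1 * (t.+1%:R *
     \sum_(D in configs G t.+1) g (to_config D)) :> R.
  rewrite exchange_big /= !mulr_sumr.
  rewrite [in RHS](eq_bigr (fun D : {ffun G -> 'I_t.+2} => (#|G| + t)%:R^-1 *
      \sum_v ((D v)%:R * g (to_config D)))); last first.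
    move=> D; rewrite inE => /eqP Dt; congr (_ * _).
    by rewrite -mulr_suml -natr_sum Dt.
  rewrite -[RHS]mulr_sumr [X in _ = _ * X]exchange_big mulr_sumr /=.
  apply: eq_bigr => v _; rewrite sum_configs_at mulr_sumr.
  by apply: eq_bigr => D _; rewrite ffunE mulrCA !mulrA; congr (_ * _); rewrite mulrC.
have H : t.+1%:R * #|configs G t.+1|%:R = (#|G| + t)%:R * #|configs G t|%:R :> R.
  by rewrite -!natrM card_configsS.
have cancel (a N c d S : R) : a != 0 -> N != 0 -> c != 0 -> d != 0 ->
    a * c = N * d -> a * (S / c) = a * (N^-1 * (a * S) / d).
  move=> a0 N'0 c'0 d0 E.
  transitivity (a * (a * S / (N * d))); last by field; rewrite N'0 d0.
  by rewrite -E; field; rewrite a0 c'0.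
exact: cancel.
Qed.

Lemma sum_urn_weight t C : csize C = t ->
  \sum_v (C v).+1%:R / (#|G| + t)%:R = 1 :> R.
Proof.
move=> <-; rewrite -mulr_suml -natr_sum.
have -> : (\sum_v (C v).+1 = #|G| + csize C)%N.
  rewrite /csize -[#|G|]sum1_card -big_split /=.
  by apply: eq_bigr => v _; rewrite add1n.
by rewrite divff // pnatr_eq0; lia.
Qed.

Lemma le_mean t g h : (forall C, csize C = t -> g C <= h C) ->
  mean t g <= mean t h.
Proof.
move=> gh; apply: ler_wpM2r; first by rewrite invr_ge0.
apply: ler_sum => D; rewrite inE => /eqP Dt.
by apply: gh; rewrite csize_to_config.
Qed.

Lemma eq_mean t g h : (forall C, csize C = t -> g C = h C) ->
  mean t g = mean t h.
Proof.
by move=> gh; apply/eqP; rewrite eq_le !le_mean // => C /gh ->.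
Qed.

Lemma mean_cst t (c : R) : mean t (fun=> c) = c.
Proof.
rewrite /mean sumr_const -[c in LHS]mulr1 -mulrnAr mulfK //.
by rewrite pnatr_eq0 -lt0n card_configs_gt0.
Qed.

Lemma meanD t g h : mean t (fun C => g C + h C) = mean t g + mean t h.
Proof. by rewrite /mean big_split mulrDl. Qed.

Lemma meanZ t (c : R) g : mean t (fun C => c * g C) = c * mean t g.
Proof. by rewrite /mean -mulr_sumr mulrA. Qed.

Lemma mean_sum t (I : finType) (P : pred I) (F : I -> config G -> R) :
  mean t (fun C => \sum_(i | P i) F i C) = \sum_(i | P i) mean t (F i).
Proof. by rewrite /mean exchange_big mulr_suml. Qed.

(** The urn couples a configuration of [s] pebbles with a larger one of [t] pebbles. *)
Lemma mean_homo g s t : (forall v C, g C <= g (add_pebble v C)) ->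
  (s <= t)%N -> mean s g <= mean t g.
Proof.
move=> gmono; elim: t => [|t IH]; first by rewrite leqn0 => /eqP ->.
rewrite leq_eqVlt ltnS => /predU1P[-> //|/IH /le_trans]; apply.
rewrite meanS; apply: le_mean => C Ct.
rewrite -[g C]mul1r -(sum_urn_weight Ct) mulr_suml.
by apply: ler_sum => v _; apply: ler_wpM2l.
Qed.

(** For [csize C = t], this is the expectation of [g] after [k] further urn pebbles, conditional on
    the present configuration [C]. *)
Fixpoint urn_steps t k g C : R :=
  if k is k'.+1 then urn_step t (urn_steps t.+1 k' g) C else g C.

Lemma mean_urn_steps t k g : mean (t + k) g = mean t (urn_steps t k g).
Proof.
elim: k t => [|k IH] t; first by rewrite addn0.
by rewrite addnS -addSn IH meanS.
Qed.

(** While [M] is empty the next pebble hits it with probability [|M| / (N + t)], at least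
    [|M| / (2 N)] as long as [t <= N]; once hit, [M] stays occupied. *)
Lemma mean_avoid t (M : {set G}) : (t <= #|G|)%N ->
  mean t (fun C => [forall v in M, C v == 0]%N%:R) <=
    (1 - #|M|%:R / (2 * #|G|)%:R) ^+ t.
Proof.
elim: t => [|t IH] tN.
  rewrite expr0 -[leRHS](mean_cst 0); apply: le_mean => C _.
  by case: [forall _ in _, _].
rewrite meanS exprSr.
apply: (@le_trans _ _ (mean t (fun C => (1 - #|M|%:R / (2 * #|G|)%:R) *
    [forall v in M, C v == 0]%N%:R))); last first.
  rewrite meanZ mulrC; apply: ler_wpM2r; last by apply: IH; lia.
  rewrite subr_ge0 ler_pdivrMr ?ltr0n; last by lia.
  by rewrite mul1r ler_nat; apply: leq_trans (max_card _) _; rewrite leq_pmull.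
apply: le_mean => C Ct; rewrite /urn_step.
case: (boolP [forall v in M, C v == 0]%N) => [/forall_inP CM|].
  rewrite mulr1 (bigID (mem M)) /= big1 ?add0r; last first.
    move=> v vM; case: forall_inP => [/(_ v vM)|]; rewrite ?mulr0 //.
    by rewrite ffunE eqxx addn1.
  apply: (@le_trans _ _ (\sum_(v | v \notin M) (C v).+1%:R / (#|G| + t)%:R)).
    by apply: ler_sum => v _; apply: ler_piMr => //; case: [forall _ in _, _].
  rewrite lerBrDr -[leRHS](sum_urn_weight Ct) [leRHS](bigID (mem M)) /= addrC.
  apply: lerD => //.
  rewrite (eq_bigr (fun=> (#|G| + t)%:R^-1)); last first.
    by move=> v /CM /eqP ->; rewrite div1r.
  rewrite sumr_const -[leRHS]mulr_natl; apply: ler_wpM2l => //.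
  rewrite lef_pV2 ?posrE ?ltr0n ?muln_gt0 ?addn_gt0 ?G_gt0 // ler_nat.
  by rewrite mul2n -addnn leq_add2l ltnW.
rewrite negb_forall => /existsP[w]; rewrite negb_imply => /andP[wM Cw].
rewrite mulr0 big1 // => v _; case: forall_inP => [/(_ w wM)|]; rewrite ?mulr0 //.
by rewrite ffunE addn_eq0 (negPf Cw).
Qed.

Lemma mean_pairs t :
  mean t (fun C => \sum_v (C v * (C v).-1)%:R) =
    (2 * t * t.-1)%:R / (#|G|.+1)%:R.
Proof.
elim: t => [|t IH].
  rewrite muln0 mul0r -[RHS](mean_cst 0); apply: eq_mean => C.
  rewrite /csize => /eqP; rewrite sum_nat_eq0 => /forallP C0.
  by apply: big1 => v _; have /eqP -> := C0 v.
have N0 : (#|G| + t)%:R != 0 :> R by rewrite pnatr_eq0; lia.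
(* A new pebble on [v] raises the sum by [2 * C v]; averaging over the urn weights gives a linear
   recursion, which the closed form satisfies. *)
rewrite meanS (@eq_mean _ _ (fun C => (1 + 2 / (#|G| + t)%:R) *
  (\sum_v (C v * (C v).-1)%:R) + (4 * t)%:R / (#|G| + t)%:R)).
  rewrite meanD meanZ IH mean_cst /= -(natr1 #|G|) !natrM -(natr1 t) (natrD _ #|G| t).
  (* At [t = 0] the truncated predecessor is harmless, since the factor [t] vanishes. *)
  have -> : 2 * t%:R * t.-1%:R = 2 * t%:R * (t%:R - 1) :> R.
    case: t {IH N0} => [|t] /=; first by rewrite !(mulr0n, mulr0, mul0r).
    by rewrite -(natr1 t) addrK.
  have N1 : #|G|%:R + 1 != 0 :> R by rewrite natr1 pnatr_eq0.
  by move: N0 N1; rewrite (natrD _ #|G| t); move: #|G|%:R t%:R => N x N0 N1; field; rewrite N0 N1.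
move=> C Ct; rewrite /urn_step.
under eq_bigr => v _.
  rewrite (_ : \sum_w _ = (\sum_w (C w * (C w).-1)%:R) + (2 * C v)%:R); last first.
    rewrite (bigD1 v) //= [X in _ = X + _](bigD1 v) //= ffunE eqxx addn1 /=.
    rewrite addrAC; congr (_ + _); last first.
      by apply: eq_bigr => w /negPf wv; rewrite ffunE wv addn0.
    by rewrite -natrD; congr (_%:R); case: (C v) => [|c] /=; lia.
  rewrite mulrDr; over.
rewrite big_split /= -mulr_suml (sum_urn_weight Ct).
set S := \sum_w _.
have -> : \sum_v (C v).+1%:R / (#|G| + t)%:R * (2 * C v)%:R =
    (2 * S + (4 * t)%:R) / (#|G| + t)%:R.
  rewrite mulrDl mulr_sumr -Ct /csize big_distrr /= natr_sum !mulr_suml -big_split /=.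
  apply: eq_bigr => v _; rewrite mulrAC -mulrDl; congr (_ / _).
  by rewrite -!(natrM, natrD); congr (_%:R); case: (C v) => [|c] /=; lia.
by move: (#|G| + t)%:R N0 (4 * t)%:R => z z0 y; field.
Qed.

End UniformConfiguration.

(** * Solvability *)

Section Solvability.
Variable G : sgraph.
Implicit Types (C D : config G) (r u v w m : G).

Definition move u v C : config G :=
  [ffun w => if w == u then (C w - 2)%N
             else if w == v then (C w).+1 else C w].

Lemma solvable_at_move u v r C : adj u v -> (2 <= C u)%N ->
  solvable_at r (move u v C) -> solvable_at r C.
Proof.
move=> uv Cu [C' [CC' C'r]]; exists C'; split=> //.
by apply: rt_trans CC'; apply: rt_step; exists u, v.
Qed.

Lemma solvable_at_pos r C : (0 < C r)%N -> solvable_at r C.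
Proof. by move=> Cr; exists C; split=> //; apply: rt_refl. Qed.

Lemma adj_neq u v : adj u v -> u != v.
Proof. by apply: contraTneq => ->; rewrite adj_irrefl. Qed.

Lemma solvable_at_adj u r C : u = r \/ adj u r -> (2 <= C u)%N ->
  solvable_at r C.
Proof.
case=> [-> Cr|ur Cu]; first by apply: solvable_at_pos; lia.
apply: (solvable_at_move ur Cu); apply: solvable_at_pos.
by rewrite ffunE eqxx eq_sym (negPf (adj_neq ur)).
Qed.

Lemma solvable_at_le r C D : (forall v, C v <= D v)%N ->
  solvable_at r C -> solvable_at r D.
Proof.
move=> CD [C' [CC' C'r]].
suff [D' [DD' C'D']] : exists D', clos_refl_trans _ (@pebbling_step G) D D' /\
    forall v, (C' v <= D' v)%N.
  by exists D'; split=> //; apply: leq_trans C'r _.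
elim: CC' D CD {C'r} => [{}C {}C' [u [v [uv Cu ->]]] D CD|{}C D CD|].
- exists (move u v D); split.
    by apply: rt_step; exists u, v; split=> //; apply: leq_trans Cu _.
  by move=> w; rewrite !ffunE; have := CD w; case: ifP => _; [|case: ifP => _]; lia.
- by exists D; split=> //; apply: rt_refl.
move=> C1 C2 C3 _ IH1 _ IH2 D /IH1[D1 [DD1 /IH2[D2 [D12 C3D2]]]].
by exists D2; split=> //; apply: rt_trans D12.
Qed.

Lemma config_solvable_le C D : (forall v, C v <= D v)%N ->
  config_solvable C -> config_solvable D.
Proof. by move=> CD + r => /(_ r); apply: solvable_at_le. Qed.

(** The last clause keeps the two pairs disjoint when they share a vertex. *)
Definition two_pairs u w C : Prop :=
  [/\ 2 <= C u, 2 <= C w & u = w -> 4 <= C u]%N.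

(** Each pair sends one pebble to the meeting vertex [m], and the two pebbles there send one to [r];
    a pair already on [m] suffices alone. *)
Lemma solvable_at_two_pairs u w m r C : two_pairs u w C ->
  u = m \/ adj u m -> w = m \/ adj w m -> m = r \/ adj m r -> solvable_at r C.
Proof.
case=> Cu Cw Cuw um wm mr.
case: um => [um|um]; first by apply: solvable_at_adj mr _; rewrite -um.
case: wm => [wm|wm]; first by apply: solvable_at_adj mr _; rewrite -wm.
have umF := negPf (adj_neq um); have wmF := negPf (adj_neq wm).
apply: (solvable_at_move um Cu); apply: (solvable_at_move wm).
  rewrite ffunE wmF; case: eqVneq => // wu.
  by have := Cuw (esym wu); rewrite wu; lia.
apply: solvable_at_adj mr _.
by rewrite ffunE eq_sym wmF eqxx ffunE eq_sym umF eqxx.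
Qed.

(* A pair of pebbles travels along occupied vertices: its first step puts a
   second pebble on the next vertex of the path. *)
Lemma solvable_at_walk r C u w p :
  (forall C' x y, adj x y -> (2 <= C' x)%N -> (2 <= C' y)%N ->
     solvable_at r C') ->
  path (@adj G) u p -> uniq (u :: p) -> last u p = w -> u != w ->
  (2 <= C u)%N -> (2 <= C w)%N -> all (fun v => 0 < C v)%N p ->
  solvable_at r C.
Proof.
move=> base; elim: p u C => [|v p IH] u C /=; first by move=> _ _ ->; rewrite eqxx.
move=> /andP[uv vp] /andP[up vU] lastw uw Cu Cw /andP[Cv Cp].
have [vw|vw] := eqVneq v w; first by apply: (base C u v) => //; rewrite vw.
have vu := negPf (adj_neq uv).
apply: (solvable_at_move uv Cu); apply: (IH v) => //.
- by rewrite ffunE eq_sym vu eqxx.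
- by rewrite ffunE eq_sym (negPf uw) eq_sym (negPf vw).
(* Only [u] loses pebbles, and it does not recur on a simple path. *)
apply/allP => x xp; have := allP Cp x xp; rewrite ffunE.
case: eqVneq => [xu|_]; first by move: up; rewrite inE -xu xp orbT.
by case: eqP.
Qed.

(** Without two pebbles on a vertex no step is possible, so [C] reaches only itself and must already
    occupy every root. *)
Lemma solvable_needs_pair C : config_solvable C ->
  (exists v, 2 <= C v)%N \/ (forall v, 0 < C v)%N.
Proof.
move=> Csol; have [[v Cv]|noC] := pselect (exists v, 2 <= C v)%N; first by left; exists v.
right=> v; have [C' [CC' C'v]] := Csol v.
suff -> : C = C' by [].
elim: CC' noC {C'v Csol} => [{}C {}C' [u [w [_ Cu _]]] noC|//|C1 C2 C3 _ IH1 _ IH2 noC].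
  by case: noC; exists u.
by rewrite IH1 // IH2 // -IH1.
Qed.

(** Either some vertex holds four pebbles, or each contributes at most 2 to the sum and two distinct
    vertices must contribute. *)
Lemma two_pairs_of_excess C (Y : {set G}) :
  (\sum_(v in Y) (C v).-1 > 2)%N ->
  exists u w, [/\ u \in Y, w \in Y & two_pairs u w C].
Proof.
move=> Y2.
have [u uY Cu] : exists2 u, u \in Y & (2 <= C u)%N.
  apply: contrapT => noC; suff : (\sum_(v in Y) (C v).-1 = 0)%N by lia.
  apply: big1 => v vY; apply/eqP; rewrite -leqn0 leqNgt; apply/negP => Cv.
  by apply: noC; exists v => //; lia.
have [u4|u4] := leqP 4 (C u); first by exists u, u; split.
rewrite (bigD1 u) //= in Y2.
have [w /andP[wY wu] Cw] : exists2 w, (w \in Y) && (w != u) & (2 <= C w)%N.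
  apply: contrapT => noC.
  suff : (\sum_(v in Y | v != u) (C v).-1 = 0)%N by lia.
  apply: big1 => v vY; apply/eqP; rewrite -leqn0 leqNgt; apply/negP => Cv.
  by apply: noC; exists v => //; lia.
by exists u, w; split=> //; split=> // uw; rewrite uw eqxx in wu.
Qed.

End Solvability.

(** * Lines, cuts and components in the square of a complete graph *)

Section CompleteSquare.
Variable n : nat.
Local Notation K2 := (complete_square n).
Implicit Types (C : config K2) (u v w r : K2) (S : {set 'I_n} * {set 'I_n}).

Lemma square_adjE u v : @adj K2 u v = (u != v) && ((u.1 == v.1) || (u.2 == v.2)).
Proof.
rewrite /= /cartesian_adj /= /complete_adj -pair_eqE /= /pair_eq.
by case: (u.1 == v.1); case: (u.2 == v.2).
Qed.

Lemma square_adj_or_eq u v : (u.1 == v.1) || (u.2 == v.2) -> u = v \/ @adj K2 u v.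
Proof.
by rewrite square_adjE => ->; case: eqVneq => [|_]; [left|right].
Qed.

(** The pairs meet where their common line crosses the perpendicular line through [r]. *)
Lemma two_pairs_on_line C u w : two_pairs u w C ->
  (u.1 == w.1) || (u.2 == w.2) -> config_solvable C.
Proof.
move=> Cuw; case/orP=> /eqP uw r.
  by apply: (@solvable_at_two_pairs K2 u w (u.1, r.2) r C Cuw);
    apply: square_adj_or_eq; rewrite /= ?uw eqxx ?orbT.
by apply: (@solvable_at_two_pairs K2 u w (r.1, u.2) r C Cuw);
  apply: square_adj_or_eq; rewrite /= ?uw eqxx ?orbT.
Qed.

(** Only the target is constrained: from a start in [Y], paths then stay in [Y]. *)
Definition adj_into (Y : {set K2}) : rel K2 := [rel u v | @adj K2 u v && (v \in Y)].

Lemma connected_excess_solvable C (Y : {set K2}) :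
  (forall v, v \in Y -> 0 < C v)%N ->
  {in Y &, forall u v, connect (adj_into Y) u v} ->
  (2 < \sum_(v in Y) (C v).-1)%N -> config_solvable C.
Proof.
move=> CY Yc /two_pairs_of_excess[u [w [uY wY Cuw]]].
have [uw|uw] := eqVneq u w.
  by apply: two_pairs_on_line Cuw _; rewrite uw eqxx.
move: (Yc u w uY wY) => /connectP[p0 up0 wE] r.
case/shortenP: up0 wE => p up pU _ wE.
case: Cuw => Cu Cw _.
apply: (solvable_at_walk (u := u) (w := w) (p := p)) => //.
- move=> C' x y xy Cx Cy; apply: (@two_pairs_on_line C' x y).
    by split=> // xy'; rewrite xy' adj_irrefl in xy.
  by move: xy; rewrite square_adjE => /andP[].
- by apply: sub_path up => x y /andP[].
elim: p u {Cu uY wE pU uw} up => //= x p IH u /andP[/andP[_ xY]] /IH ->.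
by rewrite CY.
Qed.

(** [S] is a vertex set of [K_{n,n}], rows and columns. It is closed when no occupied edge leaves
    it, so it is a union of components of the occupied bipartite graph. *)
Definition closed_pair C (S : {set 'I_n} * {set 'I_n}) : bool :=
  [forall v : K2, (0 < C v)%N ==> ((v.1 \in S.1) == (v.2 \in S.2))].

Lemma closed_pairP C S : reflect
  (forall v : K2, (0 < C v)%N -> (v.1 \in S.1) = (v.2 \in S.2)) (closed_pair C S).
Proof.
apply: (iffP forallP) => H v; first by move: (H v) => /implyP + Cv => /(_ Cv)/eqP.
by apply/implyP => /H ->.
Qed.

Definition balanced_pair (S : {set 'I_n} * {set 'I_n}) : bool :=
  (2 * n <= 3 * (#|S.1| + #|S.2|) <= 4 * n)%N.

Definition cut_cells (S : {set 'I_n} * {set 'I_n}) : {set K2} :=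
  [set v : K2 | (v.1 \in S.1) != (v.2 \in S.2)].

Lemma balanced_product (a a' b b' m : nat) : (a + a' = m -> b + b' = m ->
  2 * m <= 3 * (a + b) -> 3 * (a + b) <= 4 * m ->
  m ^ 2 <= 3 * (a * b' + a' * b))%N.
Proof.
move=> am bm /subnKC; set x := (_ - _)%N => xE /subnKC; set y := (_ - _)%N => yE.
have agm : (4 * (a * b) <= (a + b) ^ 2)%N by rewrite nat_AGM2.
(* The product of the two slacks is nonnegative; this is the bound [s (2 m - s) >= 8 m ^ 2 / 9]
   written without subtraction. *)
have xy : (x * y + 9 * (a + b) ^ 2 + 8 * m ^ 2 = 18 * ((a + b) * m))%N.
  clearbody x y; nia.
have am2 : (a * m + b * m = a * b' + a' * b + 2 * (a * b))%N by nia.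
clearbody x y; nia.
Qed.

Lemma card_cut_cells S : balanced_pair S -> (#|K2| <= 3 * #|cut_cells S|)%N.
Proof.
case: S => A B; rewrite /balanced_pair card_complete_square /= => AB.
have -> : cut_cells (A, B) = finset.setX A (~: B) :|: finset.setX (~: A) B.
  by apply/setP => v; rewrite !inE /=; case: (_ \in A); case: (_ \in B).
rewrite cardsU (_ : _ :&: _ = finset.set0); last first.
  by apply/setP => v; rewrite !inE /=; case: (_ \in A); case: (_ \in B).
rewrite cards0 subn0 !cardsX.
have := cardsC A; have := cardsC B; rewrite card_ord.
by move=> B' A'; case/andP: AB => AB1 AB2; exact: balanced_product A' B' AB1 AB2.
Qed.

(* Without a balanced cut, a smallest closed pair of at least a third of the
   lines is far above that size, so any splitting of it would leave a smaller
   one: it is a single component. *)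
Lemma giant_component C :
  (forall S, balanced_pair S -> ~~ closed_pair C S) ->
  exists Y : {set K2}, [/\ (n <= 3 * #|Y|)%N,
    forall v, v \in Y -> (0 < C v)%N &
    {in Y &, forall u v, connect (adj_into Y) u v}].
Proof.
move=> nocut.
pose big_closed (S : {set 'I_n} * {set 'I_n}) :=
  closed_pair C S && (2 * n <= 3 * (#|S.1| + #|S.2|))%N.
have bigT : big_closed (finset.setT, finset.setT).
  rewrite /big_closed /= !cardsT card_ord; apply/andP; split; last by lia.
  by apply/closed_pairP => v _; rewrite !inE.
case: (arg_minnP (fun S : {set 'I_n} * {set 'I_n} => #|S.1| + #|S.2|)%N bigT).
case=> A B /= /andP[/= cAB bAB] minAB.
have {}minAB (A' B' : {set 'I_n}) : closed_pair C (A', B') ->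
    (2 * n <= 3 * (#|A'| + #|B'|))%N -> (#|A| + #|B| <= #|A'| + #|B'|)%N.
  by move=> c b; apply: (minAB (A', B')); rewrite /big_closed c.
have {nocut} AB4 : (4 * n < 3 * (#|A| + #|B|))%N.
  rewrite ltnNge; apply: contraTN cAB => AB4; apply: nocut.
  by rewrite /balanced_pair /= bAB.
have An : (#|A| <= n)%N by rewrite -[n in (_ <= n)%N]card_ord max_card.
have Bn : (#|B| <= n)%N by rewrite -[n in (_ <= n)%N]card_ord max_card.
have closedAB := closed_pairP _ _ cAB; rewrite /= in closedAB.
pose Y := [set v : K2 | (0 < C v)%N && (v.1 \in A)].
have inY (v : K2) : (v \in Y) = (0 < C v)%N && (v.1 \in A) by rewrite inE.
exists Y; split.
- have arith a b y : (b <= n -> 4 * n < 3 * (a + b) -> a <= y -> n <= 3 * y)%N.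
    by lia.
  apply: (arith _ _ _ Bn AB4).
  apply: (@leq_trans #|[set v.1 | v in Y]|); last exact: leq_imset_card.
  apply: subset_leq_card; apply/fintype.subsetP => i iA.
  (* A row of [A] without occupied cell could be dropped, contradicting minimality. So [Y] has at
     least [|A| > n / 3] cells. *)
  apply: contrapT => iN.
  have : closed_pair C (A :\ i, B).
    apply/closed_pairP => v Cv /=; rewrite !inE closedAB //.
    case: eqVneq => //= vi; apply/esym/negP => vB; apply: iN.
    by apply/imsetP; exists v; rewrite ?inY ?Cv ?closedAB.
  have arith2 a b a' : (a <= n -> 4 * n < 3 * (a + b) -> a = a'.+1 ->
    (2 * n <= 3 * (a' + b) -> a + b <= a' + b) -> False)%N by lia.
  move=> /minAB; apply: (arith2 _ _ _ An AB4).
  by rewrite (cardsD1 i A) iA.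
- by move=> v; rewrite inY => /andP[].
move=> u w uY wY.
(* [Z] is the component of [u]. Its lines [A1], [B1] form a closed pair, and so do the remaining
   lines of [A], [B]. *)
pose Z := [set v : K2 | connect (adj_into Y) u v].
have ZY v : v \in Z -> v \in Y.
  rewrite inE => /connectP[p up ->].
  by elim: p u uY up {Z} => //= x p IH u _ /andP[/andP[_ xY]]; apply: IH.
have Zline v v' : v \in Z -> (0 < C v')%N -> (v.1 == v'.1) || (v.2 == v'.2) -> v' \in Z.
  move=> vZ Cv' vv'; have := ZY v vZ; rewrite inY => /andP[Cv vA].
  have v'Y : v' \in Y.
    rewrite inY Cv'; case/orP: vv' => /eqP vv'; first by rewrite -vv'.
    by rewrite closedAB // -vv' -closedAB.
  case: (square_adj_or_eq vv') => [<- //|vv'adj].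
  rewrite inE in vZ; rewrite inE; apply: connect_trans vZ _.
  by apply: connect1; apply/andP.
pose A1 := [set v.1 | v in Z]; pose B1 := [set v.2 | v in Z].
have inA1 v : (0 < C v)%N -> (v.1 \in A1) = (v \in Z).
  move=> Cv; apply/imsetP/idP => [[v' v'Z vv']|vZ]; last by exists v.
  by apply: Zline v'Z Cv _; rewrite vv' eqxx.
have inB1 v : (0 < C v)%N -> (v.2 \in B1) = (v \in Z).
  move=> Cv; apply/imsetP/idP => [[v' v'Z vv']|vZ]; last by exists v.
  by apply: Zline v'Z Cv _; rewrite vv' eqxx orbT.
have [Cu Cw] : (0 < C u)%N /\ (0 < C w)%N.
  by move: uY wY; rewrite !inY => /andP[-> _] /andP[-> _].
have uA1 : u.1 \in A1 by rewrite inA1 // inE connect0.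
have A1A : A1 \subset A.
  by apply/fintype.subsetP => i /imsetP[v /ZY]; rewrite inY => /andP[_ vA] ->.
have B1B : B1 \subset B.
  apply/fintype.subsetP => i /imsetP[v /ZY]; rewrite inY => /andP[Cv vA] ->.
  by rewrite -closedAB.
have c1 : closed_pair C (A1, B1).
  by apply/closed_pairP => v Cv /=; rewrite inA1 ?inB1.
have c2 : closed_pair C (A :\: A1, B :\: B1).
  by apply/closed_pairP => v Cv /=; rewrite !inE inA1 ?inB1 ?closedAB.
have A1c := subset_leq_card A1A; have B1c := subset_leq_card B1B.
have [b1|b1] := leqP (2 * n) (3 * (#|A1| + #|B1|)).
  have A1E : A1 = A.
    apply/eqP; rewrite eqEcard A1A /=.
    have arith a b a1 b1' : (b1' <= b -> a + b <= a1 + b1' -> a <= a1)%N by lia.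
    exact: arith B1c (minAB _ _ c1 b1).
  by move: (inA1 w Cw) wY; rewrite A1E inY inE Cw => ->.
(* If [Z] meets fewer than [2 n / 3] lines, more than [2 n / 3] of those in [A], [B] remain: a
   smaller big closed pair, which is impossible. *)
have A10 : (0 < #|A1|)%N by apply/card_gt0P; exists u.1.
have := minAB _ _ c2; rewrite !cardsD (finset.setIidPr A1A) (finset.setIidPr B1B).
have arith a b a1 b1' : (0 < a1 -> a1 <= a -> b1' <= b ->
  3 * (a1 + b1') < 2 * n -> 4 * n < 3 * (a + b) ->
  (2 * n <= 3 * (a - a1 + (b - b1')) -> a + b <= a - a1 + (b - b1')) -> False)%N.
  by lia.
by move/(arith _ _ _ _ A10 A1c B1c b1 AB4).
Qed.

End CompleteSquare.

(** * Probability of solvability *)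

Section ExcessGrowth.
Variables (R : realType) (G : sgraph).
Hypothesis G_gt0 : (0 < #|G|)%N.
Implicit Types (C : config G) (g : config G -> R) (t k : nat) (Y : {set G}).

Lemma urn_steps_le1 t k g C : (forall C', g C' <= 1) -> csize C = t ->
  urn_steps t k g C <= 1.
Proof.
move=> g1; elim: k t C => [|k IH] t C Ct /=; first exact: g1.
rewrite /urn_step -[leRHS](sum_urn_weight R G_gt0 Ct).
apply: ler_sum => v _; apply: ler_piMr => //.
by apply: IH; rewrite csize_add_pebble Ct.
Qed.

Definition excess Y C : nat := (\sum_(v in Y) (C v).-1)%N.

Lemma excess_add_pebble Y C v : (0 < C v)%N ->
  excess Y (add_pebble v C) = (excess Y C + (v \in Y))%N.
Proof.
move=> Cv; rewrite /excess.
have -> : (\sum_(w in Y) (add_pebble v C w).-1 =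
           \sum_(w in Y) ((C w).-1 + (w == v)))%N.
  apply: eq_bigr => w _; rewrite ffunE.
  by case: eqVneq => [->|]; rewrite ?addn0 // !addn1 prednK.
rewrite big_split /=; congr addn.
case: (boolP (v \in Y)) => vY.
  by rewrite (bigD1 v) //= eqxx big1 // => w /andP[_ /negPf ->].
by rewrite big1 // => w wY; case: eqVneq vY => // <-; rewrite wY.
Qed.

(* Each new pebble hits [Y] with probability at least [|Y| / #|G|] and then
   raises the excess, so [2 ^- excess] decays geometrically in mean. *)
Lemma urn_steps_excess Y (c : R) t k g C : 0 <= c ->
  (forall C', (forall v, v \in Y -> 0 < C' v)%N -> g C' <= c * 2^-1 ^+ excess Y C') ->
  (forall v, v \in Y -> 0 < C v)%N -> csize C = t -> (t + k <= #|G|)%N ->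
  urn_steps t k g C <=
    c * 2^-1 ^+ excess Y C * (1 - #|Y|%:R / (2 * #|G|)%:R) ^+ k.
Proof.
move=> c0 gY; elim: k t C => [|k IH] t C CY Ct tk /=.
  by rewrite expr0 mulr1; apply: gY.
have N0 : 0 < #|G|%:R :> R by rewrite ltr0n.
set q := 1 - _.
have q0 : 0 <= q.
  rewrite /q subr_ge0 ler_pdivrMr ?ltr0n ?muln_gt0 ?G_gt0 //.
  by rewrite mul1r ler_nat; apply: leq_trans (max_card _) _; rewrite leq_pmull.
set e := c * _.
have e0 : 0 <= e by rewrite mulr_ge0 // exprn_ge0.
pose w v : R := (C v).+1%:R / (#|G| + t)%:R.
apply: (@le_trans _ _ (\sum_v (w v - 2^-1 * (w v *+ (v \in Y))) * (e * q ^+ k))).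
  apply: ler_sum => v _; rewrite -/(w v).
  have w0 : 0 <= w v by rewrite divr_ge0.
  have CvY u : u \in Y -> (0 < add_pebble v C u)%N.
    by move=> /CY Cu; rewrite ffunE; apply: leq_trans Cu (leq_addr _ _).
  have := IH t.+1 _ CvY; rewrite csize_add_pebble Ct addSnnS => /(_ erefl tk).
  move=> /(ler_wpM2l w0)/le_trans; apply.
  case: (boolP (v \in Y)) => vY; last first.
    rewrite mulr0n mulr0 subr0; apply: ler_wpM2l => //.
    apply: ler_wpM2r; first exact: exprn_ge0.
    apply: ler_wpM2l => //; rewrite le_eqVlt; apply/orP; left; apply/eqP.
    congr (_ ^+ _); apply: eq_bigr => u uY; rewrite ffunE.
    by case: eqVneq vY => [<-|]; rewrite ?uY ?addn0.
  rewrite excess_add_pebble ?CY // vY addn1 exprS mulr1n /e.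
  have E (a b d f : R) : a * (b * (2^-1 * d) * f) = (a - 2^-1 * a) * (b * d * f).
    by field.
  by rewrite E.
rewrite -mulr_suml exprSr [leRHS]mulrA [leRHS]mulrC.
apply: ler_wpM2r; first by rewrite mulr_ge0 ?exprn_ge0.
rewrite sumrB (sum_urn_weight R G_gt0 Ct) lerB // -mulr_sumr.
have -> : #|Y|%:R / (2 * #|G|)%:R = 2^-1 * \sum_(v in Y) #|G|%:R^-1 :> R.
  by rewrite sumr_const natrM invfM mulrCA mulr_natl.
apply: ler_wpM2l => //; rewrite big_mkcond; apply: ler_sum => v _.
case: (boolP (v \in Y)) => // vY; rewrite mulr1n /w.
(* An occupied vertex has weight at least [2 / (N + t)], which is at least [1 / N] because
   [t < N]. *)
rewrite ler_pdivlMr ?ltr0n ?addn_gt0 ?G_gt0 // mulrC ler_pdivrMr //.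
rewrite -natrM ler_nat.
have arith N a : (t < N -> 0 < a -> N + t <= a.+1 * N)%N by nia.
by apply: arith (CY v vY); apply: leq_trans tk; rewrite -addn1 leq_add2l.
Qed.

(** By induction, from [(1 - x) (1 + (k + 1) x) <= 1 + k x]; it turns geometric decay into a bound
    of order [1 / (k x)]. *)
Lemma bernoulli_inv (x : R) k : 0 <= x <= 1 -> (1 - x) ^+ k * (1 + k%:R * x) <= 1.
Proof.
move=> /andP[x0 x1]; elim: k => [|k IH]; first by rewrite expr0 mul0r addr0 mulr1.
apply: le_trans IH; rewrite exprSr -mulrA; apply: ler_wpM2l.
  by rewrite exprn_ge0 // subr_ge0.
rewrite -natr1; have k0 : 0 <= k%:R :> R by [].
by nra.
Qed.

End ExcessGrowth.

(** * Probability bounds for few and for many pebbles *)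

Section CompleteSquareProbability.
Variables (R : realType) (n : nat).
Hypothesis n_gt0 : (0 < n)%N.
Local Notation K2 := (complete_square n).
Implicit Types (t : nat).

Let K2_gt0 : (0 < #|K2|)%N.
Proof. by rewrite card_complete_square expn_gt0 n_gt0. Qed.

Lemma prob_solvable_mean t : prob_solvable R complete_square n t =
  mean t (fun C : config K2 => `[< config_solvable C >]%:R).
Proof.
rewrite /prob_solvable /mean; congr (_ / _).
rewrite -sum1_card natr_sum big_mkcond [RHS]big_mkcond /=.
by apply: eq_bigr => D _; rewrite inE; case: (D \in _) => //=; case: asbool.
Qed.

Lemma prob_solvable_ge0 t : 0 <= prob_solvable R complete_square n t.
Proof. by rewrite divr_ge0. Qed.

Lemma prob_solvable_le1 t : prob_solvable R complete_square n t <= 1.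
Proof.
rewrite prob_solvable_mean -[leRHS](mean_cst K2_gt0 t); apply: le_mean => C _.
by case: asbool.
Qed.

(** Markov's inequality for the number of pairs of pebbles sharing a vertex: fewer than [n ^ 2]
    pebbles cannot cover the graph, so solvability needs such a pair. *)
Lemma prob_solvable_small t : (t < n ^ 2)%N ->
  prob_solvable R complete_square n t <= (t%:R / n%:R) ^+ 2.
Proof.
move=> tn; rewrite prob_solvable_mean.
apply: (@le_trans _ _ (mean t (fun C : config K2 =>
    2^-1 * \sum_v (C v * (C v).-1)%:R))).
  apply: le_mean => C Ct; case: asboolP => [/solvable_needs_pair[[v Cv]|Cpos]|_].
  - rewrite ler_pdivlMl // mulr1 (bigD1 v) //= -[leLHS]addr0 lerD ?sumr_ge0 //.
    by rewrite (ler_nat _ 2); case: (C v) Cv => [|[|c]] //= _; nia.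
  - suff : (#|K2| <= t)%N by rewrite card_complete_square leqNgt tn.
    rewrite -Ct -sum1_card; exact: leq_sum.
  by rewrite mulr_ge0 // sumr_ge0.
rewrite meanZ mean_pairs // card_complete_square expr_div_n -!natrX.
rewrite mulrA ler_pdivrMr ?ltr0n // mulrAC ler_pdivlMr ?ltr0n ?expn_gt0 ?n_gt0 //.
rewrite -mulrA ler_pdivrMl // -!natrM ler_nat.
have : (t.-1 <= t)%N by lia.
nia.
Qed.

Lemma prob_solvable_mono s t : (s <= t)%N ->
  prob_solvable R complete_square n s <= prob_solvable R complete_square n t.
Proof.
rewrite !prob_solvable_mean; apply: mean_homo => // v C.
case: asboolP => // Csol; case: asboolP => // -[].
by apply: config_solvable_le Csol => w; rewrite ffunE leq_addr.
Qed.

Lemma prob_solvable_large B : (0 < B)%N -> (12 + B <= n)%N ->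
  1 - prob_solvable R complete_square n ((12 + B) * n) <=
    2^-1 ^+ n + 24 / B%:R.
Proof.
move=> B0 Bn; pose k := (B * n)%N; pose s := (12 * n)%N.
pose g (C : config K2) : R := (~~ `[< config_solvable C >])%:R.
have -> : 1 - prob_solvable R complete_square n ((12 + B) * n) = mean (s + k) g.
  rewrite -mulnDl -[1](mean_cst K2_gt0 ((12 + B) * n)) prob_solvable_mean.
  apply/eqP; rewrite subr_eq -meanD; apply/eqP; apply: eq_mean => C _.
  by rewrite /g; case: asbool; rewrite ?addr0 ?add0r.
(* The total stays within [N], as the hitting bounds of both phases require. *)
have skN : (s + k <= #|K2|)%N.
  by rewrite card_complete_square /s /k -mulnDl -mulnn leq_mul2r Bn orbT.
have n0 : 0 < n%:R :> R by rewrite ltr0n.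
rewrite mean_urn_steps //.
pose cut S (C : config K2) : R := [forall v in cut_cells S, C v == 0]%N%:R.
apply: (@le_trans _ _ (mean s (fun C : config K2 =>
    \sum_(S | balanced_pair S) cut S C + 24 / B%:R))); last first.
  rewrite meanD mean_cst // lerD2r mean_sum.
  (* A balanced cut has at least [N / 3] cells, so [1 - |M| / (2 N) <= 5 / 6]. *)
  apply: (@le_trans _ _ (\sum_(S : {set 'I_n} * {set 'I_n}) (5 / 6) ^+ s)).
    rewrite big_mkcond; apply: ler_sum => S _; case: ifP => Sb; last first.
      by rewrite exprn_ge0.
    apply: le_trans (mean_avoid R K2_gt0 _ _) _.
      by apply: leq_trans skN; rewrite leq_addr.
    have N0 : 0 < (2 * #|K2|)%:R :> R by rewrite ltr0n muln_gt0 K2_gt0.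
    apply: lerXn2r; rewrite ?nnegrE.
    - rewrite subr_ge0 ler_pdivrMr // mul1r ler_nat.
      by apply: leq_trans (max_card _) _; rewrite leq_pmull.
    - by [].
    rewrite lerBlDr -lerBlDl ler_pdivlMr //.
    have := card_cut_cells Sb; rewrite -(ler_nat R) !natrM => H.
    by lra.
  have card_sets : #|{: {set 'I_n}}| = (2 ^ n)%N.
    by rewrite -cardsT -powersetT card_powerset cardsT card_ord.
  (* There are [4 ^ n] pairs, and [4 * (5 / 6) ^ 12 < 1 / 2]; hence the 12. *)
  rewrite sumr_const card_prod card_sets.
  rewrite -[leLHS]mulr_natl natrM !natrX /s exprM -!exprMn.
  apply: lerXn2r; rewrite ?nnegrE //; lra.
apply: le_mean => C Cs.
(* For a closed balanced pair the cut cells are empty, so its term in the union bound is already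
   1. *)
have [[S [Sb Sc]]|nocut] := pselect (exists S, balanced_pair S /\ closed_pair C S).
  apply: (@le_trans _ _ 1).
    by apply: urn_steps_le1 => // C'; rewrite /g; case: asbool.
  rewrite (bigD1 S) //= /cut.
  have -> : [forall v in cut_cells S, C v == 0]%N.
    apply/forall_inP => v; rewrite inE; apply: contraR; rewrite -lt0n => Cv.
    by apply/eqP/(closed_pairP C S).
  by rewrite -addrA lerDl addr_ge0 ?divr_ge0 ?sumr_ge0.
have [] := @giant_component n C.
  by move=> S Sb; apply/negP => Sc; apply: nocut; exists S.
move=> Y [nY CY Yconn].
(* An unsolvable configuration occupying [Y] has excess at most 2, so the factor 4 makes the
   exponential dominate the failure indicator. *)
apply: (@le_trans _ _ (4 * 2^-1 ^+ excess Y C *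
   (1 - #|Y|%:R / (2 * #|K2|)%:R) ^+ k)).
  apply: urn_steps_excess => // C' C'Y.
  rewrite /g; case: asboolP => C'sol /=; first by rewrite mulr_ge0 ?exprn_ge0.
  have : (excess Y C' <= 2)%N.
    by rewrite leqNgt; apply/negP => /(connected_excess_solvable C'Y Yconn).
  by case: (excess Y C') => [|[|[|]]] // _; rewrite ?expr0 ?expr1 ?expr2; lra.
rewrite -[leLHS]add0r; apply: lerD; first exact: sumr_ge0.
(* From [|Y| >= n / 3] and [N = n ^ 2], [x] bounds the decay rate below. Then [k x = B / 6], and
   [4 / (1 + B / 6) <= 24 / B]. *)
pose x : R := (6 * n)%:R^-1.
have x01 : 0 <= x <= 1.
  apply/andP; split; first by rewrite invr_ge0.
  by rewrite /x invf_le1 ?ltr0n ?muln_gt0 ?n_gt0 // (ler_nat _ 1) muln_gt0 n_gt0.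
have Yx : x <= #|Y|%:R / (2 * #|K2|)%:R :> R.
  rewrite /x ler_pdivlMr ?ltr0n ?muln_gt0 ?K2_gt0 // mulrC.
  rewrite ler_pdivrMr ?ltr0n ?muln_gt0 ?n_gt0 // -natrM ler_nat.
  by rewrite card_complete_square; nia.
have Y1 : #|Y|%:R / (2 * #|K2|)%:R <= 1 :> R.
  rewrite ler_pdivrMr ?ltr0n ?muln_gt0 ?K2_gt0 // mul1r ler_nat.
  by apply: leq_trans (max_card _) _; rewrite leq_pmull.
have [x0 x1] := andP x01.
apply: (@le_trans _ _ (4 * (1 - x) ^+ k)).
  apply: ler_pM => //.
  - by rewrite exprn_ge0 // subr_ge0.
  - by rewrite ler_piMr // exprn_ile1 //; lra.
  by apply: lerXn2r; rewrite ?nnegrE ?subr_ge0 // lerB.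
have := bernoulli_inv k x01.
have -> : k%:R * x = B%:R / 6 :> R.
  by rewrite /x /k !natrM; field; rewrite gt_eqF.
have B1 : 0 < B%:R :> R by rewrite ltr0n.
have : 0 <= (1 - x) ^+ k :> R by rewrite exprn_ge0 // subr_ge0.
move: (_ ^+ k) => y y0 yB; rewrite ler_pdivlMr //.
by nra.
Qed.

End CompleteSquareProbability.

(** * The threshold *)

Local Open Scope classical_set_scope.

Section Threshold.
Variable R : realType.
Implicit Types (f : nat -> R) (n k : nat).

Local Notation prob := (prob_solvable R complete_square).

Lemma prob_solvable_to1 (eps : R) : 0 < eps ->
  exists A : nat, \forall n \near \oo,
    forall m : nat, (A * n <= m)%N -> 1 - prob n m <= eps.
Proof.
move=> eps0; pose B := (Num.bound (48 / eps)).+1.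
have B48 : 24 / B%:R <= eps / 2.
  have : 48 / eps < B%:R.
    apply: lt_trans (archi_boundP _) _; first by rewrite divr_ge0 // ltW.
    by rewrite ltr_nat.
  rewrite ltr_pdivrMr // => H.
  by rewrite ler_pdivrMr ?ltr0n //; lra.
exists (12 + B)%N; exists (12 + B + Num.bound (2 / eps))%N => //= n Nn m Am.
have nB : (12 + B <= n)%N by apply: leq_trans Nn; rewrite leq_addr.
have n_gt0 : (0 < n)%N by apply: leq_trans nB.
have := @prob_solvable_large R n n_gt0 B isT nB.
have := prob_solvable_mono R n_gt0 Am.
suff : 2^-1 ^+ n <= eps / 2 :> R by lra.
rewrite exprVn -[leRHS]invrK lef_pV2 ?posrE ?exprn_gt0 ?invr_gt0 ?divr_gt0 //.
by rewrite invf_div ltW // upper_nthrootP //; apply: leq_trans Nn; rewrite leq_addl.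
Qed.

Lemma bigTheta_threshold f : (forall n, (0 < n)%N -> 0 < f n) ->
  in_bigTheta f (fun n => n%:R) -> pebbling_threshold complete_square f.
Proof.
move=> f_gt0 [[c1 [k1 [c1_gt0 _ H1]]] [c2 [k2 [c2_gt0 _ H2]]]].
have le_f : \forall n \near \oo, f n < c1 * n%:R.
  near=> n; have n_gt0 : (0 < n)%N by near: n; exact: nbhs_infty_gt.
  have /H1[_] : k1 < n%:R by near: n; exact: nbhs_infty_gtr.
  by rewrite ltr_pdivrMr // ltr0n.
have ge_f : \forall n \near \oo, n%:R < c2 * f n.
  near=> n; have n_gt0 : (0 < n)%N by near: n; exact: nbhs_infty_gt.
  have /H2[_] : k2 < n%:R by near: n; exact: nbhs_infty_gtr.
  by rewrite ltr_pdivrMr ?f_gt0.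
split=> t [nz tf]; apply/cvgrPdist_le => eps eps0.
  have [A HA] := prob_solvable_to1 eps0.
  (* With this tolerance [t n >= c2 * A.+1 * f n], hence [t n >= A * n]; the successor keeps the
     denominator positive. *)
  have d0 : 0 < (c2 * A.+1%:R)^-1 by rewrite invr_gt0 mulr_gt0 // ltr0n.
  move/cvgrPdist_le: tf => /(_ _ d0) tf.
  near=> n; have n_gt0 : (0 < n)%N by near: n; exact: nbhs_infty_gt.
  rewrite ger0_norm ?subr_ge0 ?prob_solvable_le1 //.
  have HAn : forall m : nat, (A * n <= m)%N -> 1 - prob n m <= eps by near: n.
  apply: HAn.
  have : n%:R < c2 * f n by near: n.
  have tn0 : (t n)%:R != 0 :> R by near: n.
  have : `|0 - f n / (t n)%:R| <= (c2 * A.+1%:R)^-1 by near: n.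
  have fn := f_gt0 n n_gt0.
  have tn : 0 < (t n)%:R :> R by rewrite lt0r tn0 /=.
  rewrite sub0r normrN (ger0_norm (divr_ge0 (ltW fn) (ltW tn))) ler_pdivrMr //.
  rewrite ler_pdivlMl ?mulr_gt0 ?ltr0n // => ft nf.
  rewrite -(ler_nat R) natrM; apply: le_trans ft.
  apply: (@le_trans _ _ (A%:R * (c2 * f n))).
    by apply: ler_wpM2l => //; apply: ltW.
  rewrite mulrA [A%:R * _]mulrC ler_pM2r // ler_pM2l // ler_nat //.
(* The cap at one half gives both [t n < n ^ 2] and [d ^ 2 <= eps]. *)
pose d := Num.min eps 2^-1.
have d0 : 0 < d by rewrite lt_min eps0 invr_gt0 /=.
have [de d2] : d <= eps /\ d <= 2^-1 by rewrite !ge_min !lexx orbT.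
have d10 : 0 < d / c1 by rewrite divr_gt0.
move/cvgrPdist_le: tf => /(_ _ d10) tf.
near=> n; have n_gt0 : (0 < n)%N by near: n; exact: nbhs_infty_gt.
have n0 : 0 < n%:R :> R by rewrite ltr0n.
have : f n < c1 * n%:R by near: n.
have : `|0 - (t n)%:R / f n| <= d / c1 by near: n.
have fn := f_gt0 n n_gt0.
rewrite !sub0r !normrN (ger0_norm (prob_solvable_ge0 _ _ _)).
rewrite (ger0_norm (divr_ge0 (ler0n _ _) (ltW fn))) ler_pdivrMr // => tfn fn1.
have tdn : (t n)%:R <= d * n%:R.
  apply: le_trans tfn _; rewrite -mulrA; apply: ler_wpM2l; first exact: ltW.
  by rewrite ler_pdivrMl // ltW.
apply: le_trans (@prob_solvable_small R n n_gt0 _ _) _.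
  rewrite -(ltr_nat R) natrX; apply: le_lt_trans tdn _.
  have : 1 <= n%:R :> R by rewrite ler1n.
  by nra.
apply: (@le_trans _ _ (d ^+ 2)).
  apply: lerXn2r; rewrite ?nnegrE ?divr_ge0 ?(ltW d0) // ler_pdivrMr //.
by nra.
Unshelve. all: by end_near. Qed.

(** [S] collects one witness [e k > k] for each [k]. Beyond the finitely many witnesses with
    [k < K], every member of [S] has an index at least [K]. *)
Lemma diagonal_subsequence (P : nat -> nat -> Prop) :
  (forall k, exists n, (k < n)%N /\ P k n) ->
  exists S : pred nat, (forall N, exists2 n, (N <= n)%N & S n) /\
    forall K, \forall n \near \oo, S n -> exists2 k, (K <= k)%N & P k n.
Proof.
move=> /choice[e He]; exists (fun n => `[< exists k, n = e k >]); split=> [N|K].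
  by exists (e N); [apply: ltnW; case: (He N)|apply/asboolP; exists N].
exists (\max_(k < K) e k).+1 => //= n Kn /asboolP[k nE]; exists k.
  rewrite leqNgt; apply/negP => kK.
  have := @leq_bigmax _ (fun i : 'I_K => e i) (Ordinal kK); rewrite /= -nE.
  by move/(leq_ltn_trans)/(_ Kn); rewrite ltnn.
by rewrite nE; case: (He k).
Qed.

Lemma threshold_bigO f : (forall n, (0 < n)%N -> 0 < f n) ->
  pebbling_threshold complete_square f -> in_bigO f (fun n => n%:R).
Proof.
move=> f_gt0 [_ th0]; apply: contrapT => notO.
have /diagonal_subsequence[S [Sinf SP]] :
    forall k, exists n, (k < n)%N /\ k.+1%:R * n%:R <= f n.
  move=> k; apply: contrapT => noK; apply: notO.
  exists k.+1%:R, k.+1%:R; split; rewrite ?ltr0n // => n; rewrite ltr_nat => kn.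
  have n_gt0 : (0 < n)%N by lia.
  split; first by rewrite pnatr_eq0; lia.
  rewrite ltr_pdivrMr ?ltr0n // ltNge; apply/negP => fk.
  by apply: noK; exists n; split=> //; lia.
have [A HA] := @prob_solvable_to1 4^-1 ltac:(by rewrite invr_gt0).
(* On [S] the ratio [f n / n] tends to infinity, so [t] is negligible against [f]; yet on [S]
   solvability eventually has probability at least 3/4. *)
pose t n := if S n then (A * n)%N else 0%N.
have tf : much_less (fun n => (t n)%:R) f.
  split.
    near=> n; have n_gt0 : (0 < n)%N by near: n; exact: nbhs_infty_gt.
    by rewrite gt_eqF // f_gt0.
  apply/cvgrPdist_le => eps eps0; have SPK := SP (Num.bound (A%:R / eps)).
  near=> n; have n_gt0 : (0 < n)%N by near: n; exact: nbhs_infty_gt.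
  have fn := f_gt0 n n_gt0; have n0 : 0 < n%:R :> R by rewrite ltr0n.
  rewrite sub0r normrN (ger0_norm (divr_ge0 (ler0n _ _) (ltW fn))) ler_pdivrMr // /t.
  case: ifP => Sn; last by rewrite mulr_ge0 // ltW.
  have SPn : S n -> exists2 k, (Num.bound (A%:R / eps) <= k)%N &
    k.+1%:R * n%:R <= f n by near: n.
  have [k Kk kf] := SPn Sn.
  have : A%:R / eps < k.+1%:R.
    apply: lt_trans (archi_boundP _) _; first by rewrite divr_ge0 // ltW.
    by rewrite ltr_nat; lia.
  rewrite ltr_pdivrMr // natrM => Ak.
  apply: (@le_trans _ _ (eps * (k.+1%:R * n%:R))); last by rewrite ler_pM2l.
  by rewrite mulrA ler_pM2r // mulrC ltW // mulrC.
have /cvgrPdist_le/(_ 4^-1 ltac:(by rewrite invr_gt0)) [N1 _ H1] := th0 t tf.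
have [N2 _ H2] := HA.
have [n Nn Sn] := Sinf (maxn N1 N2).
have := H1 n (leq_trans (leq_maxl _ _) Nn).
have /(_ (t n)) := H2 n (leq_trans (leq_maxr _ _) Nn).
rewrite /t Sn leqnn sub0r normrN => /(_ isT) P1.
by rewrite ger0_norm ?prob_solvable_ge0 //; lra.
Unshelve. all: by end_near. Qed.

Lemma threshold_bigOmega f : (forall n, (0 < n)%N -> 0 < f n) ->
  pebbling_threshold complete_square f -> in_bigOmega f (fun n => n%:R).
Proof.
move=> f_gt0 [th1 _]; apply: contrapT => notO.
have /diagonal_subsequence[S [Sinf SP]] :
    forall k, exists n, (k < n)%N /\ k.+1%:R * f n <= n%:R.
  move=> k; apply: contrapT => noK; apply: notO.
  exists k.+1%:R, k.+1%:R; split; rewrite ?ltr0n // => n; rewrite ltr_nat => kn.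
  have n_gt0 : (0 < n)%N by lia.
  split; first by rewrite gt_eqF // f_gt0.
  rewrite ltr_pdivrMr ?f_gt0 // ltNge; apply/negP => fk.
  by apply: noK; exists n; split=> //; lia.
(* On [S], [f] is negligible against [n], while [n./2] pebbles succeed with probability at most 1/4.
   Off [S], [t n >= n * f n] keeps [f] negligible against [t]. *)
pose t n := if S n then n./2 else (n * Num.bound (f n))%N.
have tf : much_less f (fun n => (t n)%:R).
  have bound_gt0 n : (0 < n)%N -> (0 < Num.bound (f n))%N.
    by move=> /f_gt0 fn; rewrite -(ltr_nat R); apply: lt_trans (archi_boundP (ltW fn)).
  have t_gt0 n : (2 <= n)%N -> (0 < t n)%N.
    move=> n2; rewrite /t; case: ifP => _; first by rewrite half_gt0.
    by rewrite muln_gt0 bound_gt0 ?andbT; lia.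
  split.
    near=> n; have n2 : (2 <= n)%N by near: n; exact: nbhs_infty_ge.
    by rewrite pnatr_eq0 -lt0n t_gt0.
  apply/cvgrPdist_le => eps eps0; have SPK := SP (Num.bound (4 / eps)).
  near=> n; have n2 : (2 <= n)%N by near: n; exact: nbhs_infty_ge.
  have n_gt0 : (0 < n)%N by lia.
  have fn := f_gt0 n n_gt0; have n0 : 0 < n%:R :> R by rewrite ltr0n.
  have tn := t_gt0 n n2.
  rewrite sub0r normrN (ger0_norm (divr_ge0 (ltW fn) (ler0n _ _))) ler_pdivrMr ?ltr0n //.
  rewrite /t; case: ifP => Sn; last first.
    have : eps^-1 < n%:R by near: n; exact: nbhs_infty_gtr.
    rewrite -[eps^-1]div1r ltr_pdivrMr // => en.
    by rewrite natrM; have := archi_boundP (ltW fn); nra.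
  have SPn : S n -> exists2 k, (Num.bound (4 / eps) <= k)%N &
    k.+1%:R * f n <= n%:R by near: n.
  have [k Kk kf] := SPn Sn.
  have : 4 / eps < k.+1%:R.
    apply: lt_trans (archi_boundP _) _; first by rewrite divr_ge0 // ltW.
    by rewrite ltr_nat; lia.
  rewrite ltr_pdivrMr // => ek.
  have : n%:R <= 4 * (n./2)%:R :> R by rewrite -natrM ler_nat; lia.
  by nra.
have /cvgrPdist_le/(_ 4^-1 ltac:(by rewrite invr_gt0)) [N1 _ H1] := th1 t tf.
have [n Nn Sn] := Sinf N1.+1.
have n_gt0 : (0 < n)%N by lia.
have n0 : 0 < n%:R :> R by rewrite ltr0n.
have := H1 n (ltnW Nn).
rewrite /t Sn ger0_norm ?subr_ge0 ?prob_solvable_le1 //.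
have : (n./2 < n ^ 2)%N by nia.
move=> /(prob_solvable_small R n_gt0).
have : ((n./2)%:R / n%:R) ^+ 2 <= 4^-1 :> R.
  have -> : 4^-1 = 2^-1 ^+ 2 :> R by rewrite expr2; field.
  apply: lerXn2r; rewrite ?nnegrE ?divr_ge0 // ler_pdivrMr // ler_pdivlMl //.
  by rewrite -natrM ler_nat; lia.
by lra.
Unshelve. all: by end_near. Qed.

End Threshold.

Local Close Scope classical_set_scope.

Theorem theorem4 (R : realType) (f : nat -> R)
    (f_gt0 : forall n : nat, (0 < n)%N -> 0 < f n) :
  (pebbling_threshold complete_square f <->
     in_bigTheta f (fun n => Num.sqrt #|complete_square n|%:R)) /\
  (in_bigTheta f (fun n => Num.sqrt #|complete_square n|%:R) <->
     in_bigTheta f (fun n => n%:R)).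
Proof.
have -> : (fun n => Num.sqrt #|complete_square n|%:R) = (fun n => n%:R) :> (nat -> R).
  apply/funext => n.
  by rewrite card_complete_square natrX sqrtr_sqr ger0_norm.
split=> //; split=> [th|]; last exact: bigTheta_threshold.
by split; [exact: threshold_bigO|exact: threshold_bigOmega].
Qed.
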